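(* Let $G$ be a countably infinite group satisfying condition $(\ast)$. Then the group algebra $KG$ is primitive for any field $K$.
   Context: Condition $(\ast)$ on a group $G$: for every finite subset $M$ of $G\setminus\{1\}$ there exist three distinct elements $a,b,c\in G$ such that for every positive integer $m$, all $g_1,\dots,g_m\in M$ and all $x_1,\dots,x_m\in\{a,b,c\}$: if $(x_1^{-1}g_1x_1)\cdots(x_m^{-1}g_mx_m)=1$, then $x_i=x_{i+1}$ for some $i$ with $1\le i\le m-1$. A ring is (right) primitive if it has a faithful irreducible right module; equivalently, if it has a maximal right ideal containing no non-zero two-sided ideal. *)

(* Defs.v *)
From HB Require Import structures.
From mathcomp Require Import all_boot all_algebra finmap.
From mathcomp Require Import monalg.

Set Implicit Arguments.
Unset Strict Implicit.
Unset Printing Implicit Defensive.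

Import GRing.Theory.

Local Open Scope fset_scope.
Local Open Scope ring_scope.

(* The library equips {malg K[G]} with a product only for a monomType G, a
   structure that excludes non-trivial groups.  Here the carrier is the same
   K-vector space (finitely supported functions G -> K), under a new name so
   that it can receive the convolution product coming from the group law. *)
Definition groupAlgebra (K : fieldType) (G : groupType) : Type := {malg K[G]}.

Section GroupAlgebra.
Variables (K : fieldType) (G : groupType).

HB.instance Definition _ := GRing.Lmodule.copy (groupAlgebra K G) {malg K[G]}.

Implicit Types (u v w : groupAlgebra K G) (g h k : G).

Definition galg_one : groupAlgebra K G := << 1 *g 1%g >>.

Definition galg_mul u v : groupAlgebra K G :=
  \sum_(g <- msupp u) \sum_(h <- msupp v) << u@_g * v@_h *g (g * h)%g >>.

Lemma galg_mulw (d1 d2 : {fset G}) u v :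
  msupp u `<=` d1 -> msupp v `<=` d2 ->
  galg_mul u v = \sum_(g <- d1) \sum_(h <- d2) << u@_g * v@_h *g (g * h)%g >>.
Proof.
move=> le1 le2; rewrite /galg_mul (big_fset_incl _ le1) /=.
  apply/eq_bigr => g _; apply/big_fset_incl => // h _ /mcoeff_outdom ->.
  by rewrite mulr0 monalgU0.
move=> g _ /mcoeff_outdom ug.
by rewrite big1 // => h _; rewrite ug mul0r monalgU0.
Qed.

Lemma galg_mulDl : left_distributive galg_mul +%R.
Proof.
move=> u v w.
rewrite (galg_mulw (msuppD_le u v) (fsubset_refl (msupp w))).
rewrite (galg_mulw (fsubsetUl (msupp u) (msupp v)) (fsubset_refl (msupp w))).
rewrite (galg_mulw (fsubsetUr (msupp u) (msupp v)) (fsubset_refl (msupp w))).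
rewrite -big_split /=; apply/eq_bigr => g _.
rewrite -big_split /=; apply/eq_bigr => h _.
by rewrite mcoeffD mulrDl monalgUD.
Qed.

Lemma galg_mulDr : right_distributive galg_mul +%R.
Proof.
move=> w u v.
rewrite (galg_mulw (fsubset_refl (msupp w)) (msuppD_le u v)).
rewrite (galg_mulw (fsubset_refl (msupp w)) (fsubsetUl (msupp u) (msupp v))).
rewrite (galg_mulw (fsubset_refl (msupp w)) (fsubsetUr (msupp u) (msupp v))).
rewrite -big_split /=; apply/eq_bigr => g _.
rewrite -big_split /=; apply/eq_bigr => h _.
by rewrite mcoeffD mulrDr monalgUD.
Qed.

Lemma galg_mul0g u : galg_mul 0 u = 0.
Proof. by rewrite /galg_mul msupp0 big_seq_fset0. Qed.

Lemma galg_mulg0 u : galg_mul u 0 = 0.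
Proof. by rewrite /galg_mul big1 // => g _; rewrite msupp0 big_seq_fset0. Qed.

Lemma galg_mulUU (a b : K) g h :
  galg_mul << a *g g >> << b *g h >> = << a * b *g (g * h)%g >>.
Proof. by rewrite (galg_mulw msuppU_le msuppU_le) !big_seq_fset1 !mcoeffUU. Qed.

Lemma galg_mul_suml I (r : seq I) (F : I -> groupAlgebra K G) v :
  galg_mul (\sum_(i <- r) F i) v = \sum_(i <- r) galg_mul (F i) v.
Proof.
exact: (big_morph (galg_mul^~ v) (fun _ _ => galg_mulDl _ _ _) (galg_mul0g v)).
Qed.

Lemma galg_mul_sumr I (r : seq I) (F : I -> groupAlgebra K G) u :
  galg_mul u (\sum_(i <- r) F i) = \sum_(i <- r) galg_mul u (F i).
Proof.
exact: (big_morph (galg_mul u) (fun _ _ => galg_mulDr _ _ _) (galg_mulg0 u)).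
Qed.

Lemma galg_ind (P : groupAlgebra K G -> Prop) :
  P 0 -> (forall u v, P u -> P v -> P (u + v)) ->
  (forall (a : K) g, P << a *g g >>) -> forall u, P u.
Proof.
move=> P0 PD PU u; rewrite (monalgE u).
by apply: (big_ind P) => // g _; apply: PU.
Qed.

Lemma galg_mulA : associative galg_mul.
Proof.
move=> u v w; elim/galg_ind: u => [|u1 u2 IH1 IH2|a g].
- by rewrite !galg_mul0g.
- by rewrite !galg_mulDl IH1 IH2.
elim/galg_ind: v => [|v1 v2 IH1 IH2|b h].
- by rewrite galg_mul0g galg_mulg0 galg_mul0g.
- by rewrite galg_mulDl !galg_mulDr galg_mulDl IH1 IH2.
elim/galg_ind: w => [|w1 w2 IH1 IH2|c k].
- by rewrite !galg_mulg0.
- by rewrite !galg_mulDr IH1 IH2.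
by rewrite !galg_mulUU mulrA mulgA.
Qed.

Lemma galg_mul1g : left_id galg_one galg_mul.
Proof.
elim/galg_ind => [|u v IHu IHv|a g]; first exact: galg_mulg0.
  by rewrite galg_mulDr IHu IHv.
by rewrite galg_mulUU mul1r mul1g.
Qed.

Lemma galg_mulg1 : right_id galg_one galg_mul.
Proof.
elim/galg_ind => [|u v IHu IHv|a g]; first exact: galg_mul0g.
  by rewrite galg_mulDl IHu IHv.
by rewrite galg_mulUU mulr1 mulg1.
Qed.

Lemma galg_one_neq0 : galg_one != 0.
Proof. by rewrite monalgU_eq0 oner_eq0. Qed.

HB.instance Definition _ := GRing.Zmodule_isNzRing.Build (groupAlgebra K G)
  galg_mulA galg_mul1g galg_mulg1 galg_mulDl galg_mulDr galg_one_neq0.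

Lemma galg_scaleU (c a : K) g :
  c *: (<< a *g g >> : groupAlgebra K G) = << c * a *g g >>.
Proof. by apply/malgP => k; rewrite mcoeffZ !mcoeffU mulrnAr. Qed.

Lemma galg_scaleAl (c : K) u v : c *: (u * v) = (c *: u) * v.
Proof.
elim/galg_ind: u => [|u1 u2 IH1 IH2|a g].
- by rewrite scaler0 !mul0r scaler0.
- by rewrite mulrDl !scalerDr mulrDl IH1 IH2.
elim/galg_ind: v => [|v1 v2 IH1 IH2|b h].
- by rewrite !mulr0 scaler0.
- by rewrite mulrDr scalerDr IH1 IH2 mulrDr.
by rewrite galg_scaleU /GRing.mul /= !galg_mulUU galg_scaleU mulrA.
Qed.

HB.instance Definition _ :=
  GRing.Lmodule_isLalgebra.Build K (groupAlgebra K G) galg_scaleAl.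

Lemma galg_scaleAr (c : K) u v : c *: (u * v) = u * (c *: v).
Proof.
elim/galg_ind: u => [|u1 u2 IH1 IH2|a g].
- by rewrite !mul0r scaler0.
- by rewrite !mulrDl scalerDr IH1 IH2.
elim/galg_ind: v => [|v1 v2 IH1 IH2|b h].
- by rewrite mulr0 !scaler0 mulr0.
- by rewrite mulrDr !scalerDr IH1 IH2 mulrDr.
by rewrite galg_scaleU /GRing.mul /= !galg_mulUU galg_scaleU mulrCA.
Qed.

HB.instance Definition _ :=
  GRing.Lalgebra_isAlgebra.Build K (groupAlgebra K G) galg_scaleAr.

End GroupAlgebra.

(* Submodules are Prop-valued so that all of them are covered: a {pred V}, as
   in GRing.submod_closed, is a decidable subset. *)
Definition submodule (R : pzRingType) (V : lmodType R) (W : V -> Prop) : Prop :=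
  [/\ W 0,
      forall u v : V, W u -> W v -> W (u + v)
    & forall (a : R) (v : V), W v -> W (a *: v)].

Definition irreducible_module (R : pzRingType) (V : lmodType R) : Prop :=
  (exists v : V, v <> 0) /\
  forall W : V -> Prop, submodule W ->
    (forall v : V, W v -> v = 0) \/ (forall v : V, W v).

Definition faithful_module (R : pzRingType) (V : lmodType R) : Prop :=
  forall a : R, (forall v : V, a *: v = 0) -> a = 0.

(* A right R-module is a left module over the converse ring R^c, the right
   action v a being (a : R^c) *: v. *)
Definition right_primitive (R : nzRingType) : Prop :=
  exists V : lmodType R^c, faithful_module V /\ irreducible_module V.

(* The families g_1, .., g_m and x_1, .., x_m are indexed from
   0, and only the values of g and x at indices i < m matter. *)
Definition star_condition (G : groupType) : Prop :=
  forall M : {fset G}, 1%g \notin M ->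
  exists a b c : G,
    [/\ a != b, a != c & b != c] /\
    forall (m : nat) (g x : nat -> G),
      (0 < m)%N ->
      (forall i : nat, (i < m)%N -> g i \in M) ->
      (forall i : nat, (i < m)%N -> x i \in [:: a; b; c]) ->
      (\prod_(i < m) ((x i)^-1 * g i * x i) = 1)%g ->
      exists i : nat, (i.+1 < m)%N /\ x i = x i.+1.

Definition countably_infinite (T : Type) : Prop :=
  exists f : nat -> T, bijective f.

(* Main.v *)
Require Import Defs.
From HB Require Import structures.
From mathcomp Require Import all_boot all_algebra finmap.
From mathcomp Require boolp classical_sets.
From mathcomp Require Import monalg.
From Stdlib Require Import Classical.
From mathcomp Require Import zify.

(* Write [A = K[G]].  Every non-zero ideal of [A] contains a non-zero element
   with coefficients in the image of [int]: on a sum [u = sum f_i a_i] with the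
   [a_i] integral, [a_1 x u - u x a_1] has fewer terms, and if it vanishes for
   every [x] in [G] then [u] is a scalar multiple of [a_1].  Since [G] is
   countable, so are these integral elements; call them [e_0, e_1, ..].

   It remains to find [eps_n] in the ideal generated by [e_n] (if [e_n != 0])
   such that the right ideal [X] generated by all the [1 + eps_n] is proper: a
   maximal right ideal above [X] then contains no non-zero ideal.  Take
   [eps_n = P_n a_n], where [a_n] is a sum of three conjugates of a translate
   of [e_n] by the elements a, b, c that the condition on [G] provides, and
   [P_n] is a sum of five members of a family [p_0, p_1, ..] satisfying no
   reduced relation.  A counting argument on supports gives
   |supp w| <= |supp (a_n w)| for all [w], and
   3 sum_n |supp v_n| <= |supp (sum_n P_n v_n)| for all families [v].  Hence
   [1 = sum_n (1 + P_n a_n) w_n] is impossible: moving the [w_n] to the left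
   and putting [N = sum_n |supp (a_n w_n)|] one gets [3 N <= 1 + N]. *)

Set Implicit Arguments.
Unset Strict Implicit.
Unset Printing Implicit Defensive.

Import GRing.Theory.

Local Open Scope fset_scope.
Local Open Scope ring_scope.

(** * Walks between ports, and lower bounds for supports *)

(* A node [w] has one port [(w, t)] for each [t].  [R] links ports, and [E v a]
   records that some walk from the node [v] arrives at the port [a]; a walk
   must leave a node by another port than the one by which it arrived. *)
Section Peeling.
Variables (N : choiceType) (T : finType).
Variables (R : N * T -> N * T -> Prop) (E : N -> N * T -> Prop).
Hypothesis E1 : forall w t a, R (w, t) a -> E w a.
Hypothesis ES : forall w0 w t t1 a,
  E w0 (w, t) -> t1 != t -> R (w, t1) a -> E w0 a.
Hypothesis E_acyclic : forall w t, ~ E w (w, t).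

(** Otherwise every arrival in [W] can be continued inside [W]. By [E_acyclic] such a walk never
    returns to a node, so after as many steps as [W] has elements it has visited too many nodes. The
    first node counts as reached through [t0]. *)
Lemma peel_node (t0 : T) (W : {fset N}) : W != fset0 ->
  exists w t, w \in W /\
    forall t1 w' t', t1 != t -> w' \in W -> ~ R (w, t1) (w', t').
Proof.
case/fset0Pn => w0 w0W; apply: NNPP => noexit.
have next w t : w \in W ->
    exists t1 w' t', [/\ t1 != t, w' \in W & R (w, t1) (w', t')].
  move=> wW; apply: NNPP => h; apply: noexit; exists w, t; split=> // t1 w' t'.
  by move=> ht hw' hR; apply: h; exists t1, w', t'.
have walk n : exists q w t, [/\ size q = n, uniq (w :: q),
    {subset w :: q <= W} & forall v, v \in q -> E v (w, t)].
  elim: n => [|n [q [w [t [sz uq sW Eq]]]]].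
    by exists [::], w0, t0; split=> // v; rewrite inE => /eqP->.
  have [|t1 [w' [t' [ht w'W hR]]]] := next w t; first by apply: sW; rewrite inE eqxx.
  have Eq' v : v \in w :: q -> E v (w', t').
    by rewrite inE => /orP[/eqP->|/Eq hv]; [apply: E1 hR|apply: ES hv ht hR].
  exists (w :: q), w', t'; split=> //=; first by rewrite sz.
  - by rewrite -/(uniq (w :: q)) uq andbT; apply/negP => /Eq'; apply: E_acyclic.
  - by move=> v; rewrite inE => /orP[/eqP->//|]; apply: sW.
have [q [w [t [sz uq sW _]]]] := walk #|` W|.
by have := uniq_leq_size uq sW; rewrite /= sz ltnn.
Qed.
End Peeling.

Section Expansion.
Variables (K : fieldType) (G N : choiceType) (T S : finType).
Variables (val : N -> T -> S -> G) (E : N -> N * T -> Prop).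

(* [val] labels the points [(w, t, s)]; [collide] links two ports when distinct
   points on them have the same label. *)
Definition collide (a b : N * T) :=
  exists s s', (a, s) <> (b, s') /\ val a.1 a.2 s = val b.1 b.2 s'.

Hypothesis E1 : forall w t a, collide (w, t) a -> E w a.
Hypothesis ES : forall w0 w t t1 a,
  E w0 (w, t) -> t1 != t -> collide (w, t1) a -> E w0 a.
Hypothesis E_acyclic : forall w t, ~ E w (w, t).

Definition spread (c : N -> T -> S -> K) (w : N) : {malg K[G]} :=
  \sum_t \sum_s << c w t s *g val w t s >>.

Lemma mcoeff_spread c w g :
  (spread c w)@_g = \sum_t \sum_s c w t s *+ (val w t s == g).
Proof.
rewrite /spread raddf_sum; apply: eq_bigr => t _; rewrite raddf_sum.
by apply: eq_bigr => s _; rewrite /= mcoeffU.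
Qed.

(* Peel off a node [w] all of whose ports but one are free of collisions: this
   adds the [(#|T| - 1) * #|S|] labels of the free ports to the support and
   destroys at most the [#|S|] labels of the last port. *)
Lemma spread_expand (c : N -> T -> S -> K) (W : {fset N}) :
  {in W, forall w t s, c w t s != 0} ->
  ((#|T| - 2) * #|S| * #|` W| <= #|` msupp (\sum_(w <- W) spread c w)|)%N.
Proof.
move: {2}#|` W| (leqnn #|` W|) => n; elim: n W => [|n IH] W leW nz.
  by move: leW; rewrite leqn0 => /eqP->; rewrite muln0.
have [->|W0] := eqVneq W fset0; first by rewrite cardfs0 muln0.
have [T0|] := posnP #|T|; first by rewrite T0.
case/card_gt0P => t00 _.
have [w [t0 [wW good]]] := peel_node E1 ES E_acyclic t00 W0.
(* A label on a port of [w] other than [t0] belongs to no second point over [W], so its coefficient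
   cannot cancel. *)
have goodE t s w' t' s' : t != t0 -> w' \in W -> val w t s = val w' t' s' ->
    [/\ w = w', t = t' & s = s'].
  move=> tt0 w'W eqv; apply: NNPP => h; apply: (good t w' t' tt0 w'W).
  by exists s, s'; split=> // -[e1 e2 e3]; apply: h; split.
pose W' := W `\ w.
have cW : #|` W| = #|` W'|.+1 by rewrite (cardfsD1 w) wW.
have W'W : {subset W' <= W} by move=> v /fsetD1P[].
have leW' : (#|` W'| <= n)%N by rewrite cW in leW.
have := IH W' leW' (fun v vW' => nz v (W'W v vW')).
set F' := \sum_(v <- W') _; set F := \sum_(v <- W) _ => IHW.
have FE : F = spread c w + F' by rewrite /F (big_fsetD1 w).
have F'0 g : (forall v t s, v \in W' -> val v t s != g) -> F'@_g = 0.
  move=> h; rewrite /F' raddf_sum big1_seq // => v /andP[_ vW'].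
  rewrite /= mcoeff_spread big1 // => t _; rewrite big1 // => s _.
  by rewrite (negPf (h _ _ _ vW')).
pose U := [fset val w t0 s | s in S].
pose V := [fset val w p.1 p.2 | p in setX [set~ t0] [set: S]].
have cU : (#|` U| <= #|S|)%N.
  by apply: leq_trans (leq_imfset_card _ _ _) _; rewrite -cardE.
have cV : #|` V| = ((#|T| - 1) * #|S|)%N.
  rewrite card_in_imfset /=; last first.
    move=> [t s] [t' s']; rewrite !inE /= !andbT => ht _ /(goodE _ _ _ _ _ ht wW).
    by case=> _ -> ->.
  by rewrite -cardE cardsX cardsT cardsC1 subn1.
have sub : (msupp F' `\` U) `|` V `<=` msupp F.
  apply/fsubsetP => g /fsetUP[/fsetDP[gF' gU]|/imfsetP[[t s]]].
    rewrite -mcoeff_neq0 FE mcoeffD mcoeff_spread big1 ?add0r ?mcoeff_neq0 // => t _.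
    rewrite big1 // => s _; case: eqP => // vg; exfalso.
    have [tt0|tt0] := eqVneq t t0.
      by move/negP: gU; apply; apply/imfsetP; exists s; rewrite -?vg ?tt0.
    move: gF'; rewrite -mcoeff_neq0 => /eqP; apply; apply: F'0 => v t' s' vW'.
    apply/eqP => vg'; rewrite -vg in vg'.
    have [wv _ _] := goodE _ _ _ _ _ tt0 (W'W _ vW') (esym vg').
    by move: vW'; rewrite -wv !inE eqxx.
  rewrite !inE /= andbT => tt0 ->; rewrite -mcoeff_neq0 FE mcoeffD mcoeff_spread.
  rewrite F'0 ?addr0; last first.
    move=> v t' s' vW'; apply/eqP => vg.
    have [wv _ _] := goodE _ _ _ _ _ tt0 (W'W _ vW') (esym vg).
    by move: vW'; rewrite -wv !inE eqxx.
  rewrite (bigD1 t) //= (bigD1 s) //= eqxx mulr1n !big1 ?addr0 ?nz //.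
    move=> t' t't; rewrite big1 // => s' _; case: eqP => // /esym vg.
    by have [_ e _] := goodE _ _ _ _ _ tt0 wW vg; rewrite e eqxx in t't.
  move=> s' s's; case: eqP => // /esym vg.
  by have [_ _ e] := goodE _ _ _ _ _ tt0 wW vg; rewrite e eqxx in s's.
have dis : [disjoint msupp F' `\` U & V].
  apply/fdisjointP => g /fsetDP[gF' _]; apply/negP => /imfsetP[[t s]].
  rewrite !inE /= andbT => tt0 eg; move: gF'; rewrite -mcoeff_neq0 => /eqP; apply.
  apply: F'0 => v t' s' vW'; apply/eqP; rewrite eg => vg.
  have [wv _ _] := goodE _ _ _ _ _ tt0 (W'W _ vW') (esym vg).
  by move: vW'; rewrite -wv !inE eqxx.
have := fsubset_leq_card sub; rewrite cardfsU (_ : _ `&` V = fset0) ?cardfs0.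
  rewrite subn0 cV cardfsD => le1.
  have := fsubset_leq_card (fsubsetIr (msupp F') U) => le2.
  rewrite cW; nia.
by apply/eqP.
Qed.
End Expansion.

(** * Alternating words, and a family without reduced relations *)

Section Alternating.
Local Open Scope group_scope.
Variable G : groupType.

(* Products of conjugates [m ^ x t] in which neighbours have distinct labels;
   the index is the label of the leftmost factor. *)
Inductive alternating (T : Type) (x : T -> G) (M : {fset G}) : T -> G -> Prop :=
| alternating_one t m : m \in M -> alternating x M t (m ^ x t)
| alternating_cons t t' m h : m \in M -> t' <> t ->
    alternating x M t h -> alternating x M t' (m ^ x t' * h).

Lemma alternating_prod T (x : T -> G) M t h : alternating x M t h ->
  exists n (g : nat -> G) (X : nat -> T),
    [/\ forall i, (i < n.+1)%N -> g i \in M, X 0%N = t,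
        forall i, (i.+1 < n.+1)%N -> X i <> X i.+1
      & h = \prod_(i < n.+1) ((x (X i))^-1 * g i * x (X i))].
Proof.
elim=> {t h} [t m mM|t t' m h mM tt' _ [n [g [X [gM X0 Xne ->]]]]].
  exists 0%N, (fun=> m), (fun=> t); split=> //.
  by rewrite big_ord_recl big_ord0 mulg1 conjgE mulgA.
exists n.+1, (fun i => if i is j.+1 then g j else m).
exists (fun i => if i is j.+1 then X j else t'); split=> //.
- by case=> // i; apply: gM.
- by case=> [_|i]; [rewrite X0|apply: Xne].
- by rewrite [RHS]big_ord_recl conjgE mulgA.
Qed.

Definition non_relation (x : 'I_3 -> G) (M : {fset G}) :=
  forall t h, alternating x M t h -> h <> 1.

Lemma star_non_relation (M : {fset G}) : star_condition G -> 1 \notin M ->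
  exists x, non_relation x M.
Proof.
move=> star /star[a [b [c [[ab ac bc] H]]]].
exists (fun i => nth a [:: a; b; c] i) => t h hal; have := alternating_prod hal.
move=> [n [g [X [gM _ Xne ->]]]] prod1.
have [i _|i [lti /eqP eqX]] :=
  H n.+1 g (fun i => nth a [:: a; b; c] (X i)) isT gM _ prod1; first exact: mem_nth.
case: (Xne _ lti); apply: val_inj; apply/eqP.
by move: eqX; rewrite nth_uniq //= !inE negb_or ab ac bc.
Qed.

(* [Q l h] is an invariant of the reduced words [h] in the [(p l)^-1 * p k] that
   start with [(p l)^-1]. *)
Definition reduced_family (p : nat -> G) (Q : nat -> G -> Prop) : Prop :=
  [/\ forall l h, Q l h -> h <> 1,
      forall k l, k <> l -> Q l ((p l)^-1 * p k)
    & forall k l l' h, Q l h -> k <> l -> l' <> k -> Q l' ((p l')^-1 * p k * h)].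

(* With [A], [B], [C] the conjugates of [g] by the three elements of the star
   condition and [D = A * B], the family is [p k = D ^+ k * C * D ^+ k]: in a
   reduced word only powers of [D] meet, and their exponents never cancel. *)
Lemma star_reduced_family (g : G) : star_condition G -> g != 1 ->
  exists p Q, reduced_family p Q.
Proof.
move=> star g1; pose M := [fset g; g^-1].
have M1 : 1 \notin M.
  by rewrite !inE negb_or eq_sym g1 eq_sym invg_eq1.
have [x nonrel] := star_non_relation star M1.
have gM : g \in M by rewrite !inE eqxx.
have gVM : g^-1 \in M by rewrite !inE eqxx orbT.
pose al := alternating x M.
pose a : 'I_3 := inord 0; pose b : 'I_3 := inord 1; pose c : 'I_3 := inord 2.
have neq (i j : nat) : (i < 3)%N -> (j < 3)%N -> i <> j ->
    (inord i : 'I_3) <> inord j.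
  by move=> i3 j3 ij /(congr1 val); rewrite /= !inordK.
have ab : a <> b by apply: neq. have ac : a <> c by apply: neq.
have bc : b <> c by apply: neq.
have push t t' h : t' <> t -> al t h -> al t' (g ^ x t' * h).
  by move=> tt' alh; apply: alternating_cons alh.
have pushV t t' h : t' <> t -> al t h -> al t' ((g ^ x t')^-1 * h).
  by move=> tt' alh; rewrite -conjVg; apply: alternating_cons alh.
pose A := g ^ x a; pose B := g ^ x b; pose C := g ^ x c; pose D := A * B.
(* Before a word starting with [c], positive powers of [D] produce words starting with [a], and
   negative powers, being powers of [B^-1 * A^-1], words starting with [b]. *)
have posD j h : h = 1 \/ al c h -> al a (D ^+ j.+1 * h).
  move=> alh; elim: j => [|j IH].
    rewrite expg1 -mulgA; apply: (push _ _ _ ab); case: alh => [->|].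
      by rewrite mulg1; apply: alternating_one.
    exact: (push c).
  rewrite expgS -mulgA -(mulgA A B); apply: (push _ _ _ ab);
    exact: (push _ _ _ (nesym ab) IH).
have negD j h : al c h -> al b (D ^- j.+1 * h).
  move=> alh; elim: j => [|j IH].
    rewrite expg1 invgM -mulgA; apply: (pushV _ _ _ (nesym ab));
      exact: (pushV _ _ _ ac alh).
  rewrite expgSr invgM (invgM A B) -!mulgA; apply: (pushV _ _ _ (nesym ab));
    exact: (pushV _ _ _ ab IH).
(* Since [k <> l], a non-trivial power of [D] remains; the result does not start with [c], so [C] or
   [C^-1] can be prepended again. *)
have powD k l h : al c h -> k <> l ->
    exists2 t, t <> c & al t (D ^- l * (D ^+ k * h)).
  move=> alh kl; case: (ltngtP k l) => // lt.
    exists b => //; have -> : l = (k + (l - k).-1.+1)%N by lia.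
    by rewrite expgnDr invgM -mulgA mulKg; apply: negD.
  exists a => //; have -> : k = (l + (k - l).-1.+1)%N by lia.
  by rewrite expgnDr -mulgA mulKg; apply: posD; right.
pose p k := D ^+ k * (C * D ^+ k).
have pV k : (p k)^-1 = D ^- k * (C^-1 * D ^- k) by rewrite /p invgM (invgM C) mulgA.
(* The leading [(p l)^-1] is [D ^- l * C^-1 * D ^- l]; its last factor has merged with what follows
   into [h']. *)
pose Q l h := exists t h', [/\ t <> c, al t h' & h = D ^- l * (C^-1 * h')].
exists p, Q; split=> [l h [t [h' [tc alh' ->]]]|k l kl|k l l' h].
- have alc : al c (C^-1 * h') by apply: (pushV _ _ _ (nesym tc) alh').
  case: l => [|l]; last by apply: nonrel (negD l _ alc).
  by rewrite expg0 invg1 mul1g; apply: nonrel alc.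
- have alc : al c (C * D ^+ k).
    case: k {kl} => [|k]; first by rewrite mulg1; apply: alternating_one.
    by apply: (push a); [apply: nesym|rewrite -[_ ^+ _]mulg1; apply: posD; left].
  have [t tc alt] := powD k l _ alc kl.
  by exists t, (D ^- l * p k); split; rewrite // pV -!mulgA.
- move=> [t [h' [tc alh' ->]]] kl l'k.
  have alc : al c (C^-1 * h') by apply: (pushV _ _ _ (nesym tc) alh').
  have [t2 t2c al2] := powD k l _ alc kl.
  have alc2 := push _ c _ (nesym t2c) al2.
  have [t3 t3c al3] := powD k l' _ alc2 (nesym l'k).
  exists t3; eexists; split; [exact: t3c|exact: al3|].
  have comm : D ^+ k * D ^- l = D ^- l * D ^+ k.
    exact: commuteV (commuteX2 _ _ (commute_refl D)).
  by rewrite (mulgA (D ^- l) (D ^+ k)) -comm pV /p -!mulgA.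
Qed.
End Alternating.

(** * Products through a separating group element *)

Section MonomialProducts.
Variables (K : fieldType) (G : groupType).
Local Notation A := (groupAlgebra K G).
Implicit Types (u v w : A) (S : {fset G}).

Lemma galg_expand S u : msupp u `<=` S -> u = \sum_(g <- S) (<< u@_g *g g >> : A).
Proof. by move=> uS; rewrite [LHS](monalgEw uS). Qed.

Lemma galg_mulU (a b : K) (g h : G) :
  (<< a *g g >> : A) * (<< b *g h >> : A) = << a * b *g (g * h)%g >>.
Proof. exact: galg_mulUU. Qed.

Lemma galg_mulUr u (x : G) S : msupp u `<=` S ->
  u * (<< 1 *g x >> : A) = \sum_(g <- S) (<< u@_g *g (g * x)%g >> : A).
Proof.
move=> uS; rewrite [in LHS](galg_expand uS) mulr_suml.
by apply: eq_bigr => g _; rewrite galg_mulU mulr1.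
Qed.

Lemma galg_mulUl u (x : G) S : msupp u `<=` S ->
  (<< 1 *g x >> : A) * u = \sum_(g <- S) (<< u@_g *g (x * g)%g >> : A).
Proof.
move=> uS; rewrite [in LHS](galg_expand uS) mulr_sumr.
by apply: eq_bigr => g _; rewrite galg_mulU mul1r.
Qed.

Lemma galg_mulUm u v (x : G) S : msupp u `<=` S -> msupp v `<=` S ->
  u * (<< 1 *g x >> : A) * v =
  \sum_(g <- S) \sum_(h <- S) (<< u@_g * v@_h *g (g * x * h)%g >> : A).
Proof.
move=> uS vS; rewrite (galg_mulUr _ uS) mulr_suml; apply: eq_bigr => g _.
rewrite [in LHS](galg_expand vS) mulr_sumr; apply: eq_bigr => h _.
by rewrite galg_mulU.
Qed.

Lemma mcoeff_galg_sum I (r : seq I) (P : pred I) (F : I -> A) g :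
  (\sum_(i <- r | P i) F i)@_g = \sum_(i <- r | P i) (F i)@_g.
Proof. exact: (raddf_sum (mcoeff g)). Qed.

Lemma galg_supp_eq0 u : (msupp u == fset0) = (u == 0).
Proof.
apply/eqP/eqP => [/fsetP u0|->]; last exact: msupp0.
by apply/malgP => g; rewrite mcoeff0 mcoeff_outdom // u0.
Qed.

Definition separating (S : {fset G}) (t : G) := forall g g' h h',
  g \in S -> g' \in S -> h \in S -> h' \in S ->
  (g * t * h = g' * t * h')%g -> g = g' /\ h = h'.

Lemma mcoeff_separating S t u v g h : separating S t ->
    msupp u `<=` S -> msupp v `<=` S -> g \in S -> h \in S ->
  (u * (<< 1 *g t >> : A) * v)@_(g * t * h)%g = u@_g * v@_h.
Proof.
move=> sep uS vS gS hS; rewrite (galg_mulUm _ uS vS) mcoeff_galg_sum.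
rewrite (big_fsetD1 g gS) /= [X in _ + X]big1_seq ?addr0.
  rewrite mcoeff_galg_sum (big_fsetD1 h hS) /= [X in _ + X]big1_seq ?addr0.
    by rewrite mcoeffUU.
  move=> h' /andP[_ /fsetD1P[h'h h'S]]; rewrite mcoeffU.
  by case: eqP => // /sep[] // _ e; rewrite e eqxx in h'h.
move=> g' /andP[_ /fsetD1P[g'g g'S]]; rewrite mcoeff_galg_sum big1_seq //.
move=> h' /andP[_ h'S]; rewrite mcoeffU.
by case: eqP => // /sep[] // e _; rewrite e eqxx in g'g.
Qed.

(** For [t = x a * (x b)^-1], the equation [g * t * h = g' * t * h'] becomes an alternating relation
    of length two between [g'^-1 * g] and [h * h'^-1]. So one of these is 1, and cancellation makes
    the other one trivial too. *)
Lemma star_separating S : star_condition G -> exists t, separating S t.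
Proof.
move=> star.
pose M := ([fset (g'^-1 * g)%g | g' in S, g in S] `|`
           [fset (h * h'^-1)%g | h in S, h' in S]) `\ 1%g.
have [|x nonrel] := star_non_relation (M := M) star; first by rewrite !inE eqxx.
pose a : 'I_3 := ord0; pose b : 'I_3 := ord_max.
exists (x a * (x b)^-1)%g => g g' h h' gS g'S hS h'S e.
have e1 : (g'^-1 * g * x a * (x b)^-1 * h * h'^-1 = x a * (x b)^-1)%g.
  apply: (mulgI g'); apply: (mulIg h').
  by rewrite -e -!mulgA mulVKg mulVg mulg1.
have e2 : ((g'^-1 * g) ^ x a * (h * h'^-1) ^ x b = 1)%g.
  transitivity ((x a)^-1 * (g'^-1 * g * x a * (x b)^-1 * h * h'^-1) * x b)%g.
    by rewrite !conjgE !mulgA.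
  by rewrite e1 mulKg mulVg.
have [m1|m1] := eqVneq (g'^-1 * g)%g 1%g.
  have gg' : g = g' by rewrite -[RHS]mulg1 -m1 mulVKg.
  by move: e; rewrite gg' => /mulgI.
have [m2|m2] := eqVneq (h * h'^-1)%g 1%g.
  have hh' : h = h' by apply/divg1_eq.
  by move: e; rewrite hh' => /mulIg /mulIg.
exfalso; apply: nonrel e2; apply: (alternating_cons (t := b)) => //.
  by rewrite !inE m1 /=; apply/orP; left; apply: in_imfset2.
apply: alternating_one; rewrite !inE m2 /=; apply/orP; right; exact: in_imfset2.
Qed.

(* In other words, the extended centroid of [K[G]] is [K]. *)
Lemma star_commute_scale u a : star_condition G -> a != 0 ->
    (forall x : G, a * (<< 1 *g x >> : A) * u = u * (<< 1 *g x >> : A) * a) ->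
  exists c : K, u = c *: a.
Proof.
move=> star a0 comm; pose S := msupp a `|` msupp u.
have [t sep] := star_separating S star.
have aS : msupp a `<=` S by apply: fsubsetUl.
have uS : msupp u `<=` S by apply: fsubsetUr.
have [g ga] : exists g, g \in msupp a.
  by apply/fset0Pn; rewrite galg_supp_eq0.
have gS : g \in S by apply: (fsubsetP aS).
exists (u@_g / a@_g); apply/malgP => h; rewrite mcoeffZ.
have [hS|hS] := boolP (h \in S); last first.
  have out v : msupp v `<=` S -> v@_h = 0.
    by move=> vS; apply: mcoeff_outdom; apply: contra hS; apply: (fsubsetP vS).
  by rewrite !out // mulr0.
have ag0 : a@_g != 0 by rewrite mcoeff_neq0.
(* Comparing coefficients at [g * t * h] gives [a@_g * u@_h = u@_g * a@_h]. *)
have := congr1 (mcoeff (g * t * h)%g) (comm t).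
rewrite /= !(mcoeff_separating sep) // => e.
by apply: (mulfI ag0); rewrite e !mulrA [a@_g * _]mulrC mulfK.
Qed.
End MonomialProducts.

(** * Integral elements of two-sided ideals *)

Definition two_sided_ideal (R : nzRingType) (I : R -> Prop) : Prop :=
  [/\ I 0, forall u v, I u -> I v -> I (u + v),
      forall a u, I u -> I (a * u) & forall a u, I u -> I (u * a)].

Section IntegralElements.
Variables (K : fieldType) (G : groupType).
Local Notation A := (groupAlgebra K G).
Implicit Types (u v w : A).

Definition integral_elt u := forall g, exists z : int, u@_g = z%:~R.

Lemma integralU (z : int) g : integral_elt (<< z%:~R *g g >> : A).
Proof.
by move=> h; exists (z *+ (g == h)); rewrite mcoeffU; case: eqP => // _; rewrite mulr0n.
Qed.

Lemma integralD u v : integral_elt u -> integral_elt v -> integral_elt (u + v).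
Proof.
move=> iu iv g; have [z ez] := iu g; have [y ey] := iv g.
by exists (z + y); rewrite mcoeffD ez ey intrD.
Qed.

Lemma integralN u : integral_elt u -> integral_elt (- u).
Proof. by move=> iu g; have [z ez] := iu g; exists (- z); rewrite mcoeffN ez intrN. Qed.

Lemma integral_sum I (r : seq I) (F : I -> A) :
  (forall i, integral_elt (F i)) -> integral_elt (\sum_(i <- r) F i).
Proof.
move=> iF; elim/big_ind: _ => //; last exact: integralD.
by move=> g; exists 0; rewrite mcoeff0.
Qed.

Lemma integralM u v : integral_elt u -> integral_elt v -> integral_elt (u * v).
Proof.
move=> iu iv; apply: integral_sum => g; apply: integral_sum => h.
have [z ->] := iu g; have [y ->] := iv h.
by rewrite -intrM; apply: integralU.
Qed.

Lemma ideal_integral_comb (I : A -> Prop) (L : seq (K * A)) :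
    star_condition G -> two_sided_ideal I ->
    (forall p, p \in L -> integral_elt p.2) ->
    let u := \sum_(p <- L) p.1 *: p.2 in u != 0 -> I u ->
  exists v, [/\ integral_elt v, v != 0 & I v].
Proof.
move=> star [I0 ID IM IMr].
have IZ c u : I u -> I (c *: u).
  by move=> Iu; rewrite -[u]mul1r scalerAl; apply: IM.
have [n] := ubnP (size L); elim: n L => // n IH [|[f a] L] szL iL u u0 Iu.
  by move: u0; rewrite /u big_nil eqxx.
have ia : integral_elt a by apply: (iL (f, a)); rewrite inE eqxx.
have iL' p : p \in L -> integral_elt p.2.
  by move=> pL; apply: iL; rewrite inE pL orbT.
have [a0|a0] := eqVneq a 0.
  have uE : u = \sum_(p <- L) p.1 *: p.2 by rewrite /u big_cons a0 scaler0 add0r.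
  by rewrite uE in u0 Iu; apply: IH iL' u0 Iu.
have [[x nx]|comm] := classic (exists x : G,
    a * (<< 1 *g x >> : A) * u <> u * (<< 1 *g x >> : A) * a); last first.
  have [|c uc] := @star_commute_scale _ _ u a star a0.
    by move=> x; apply: NNPP => h; apply: comm; exists x.
  exists a; split=> //; have c0 : c != 0.
    by apply: contraNneq u0 => c0; rewrite uc c0 scale0r.
  by rewrite -[a](scalerK c0) -uc; apply: IZ.
pose X : A := << 1 *g x >>.
(* The head contributes [f *: (a * X * a)] to both products and cancels, so the list built from the
   tail alone represents the difference. *)
pose L2 := [seq (p.1, a * X * p.2 - p.2 * X * a) | p <- L].
have L2E : \sum_(p <- L2) p.1 *: p.2 = a * X * u - u * X * a.
  rewrite /u big_cons /= mulrDr !mulrDl opprD addrACA.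
  rewrite -scalerAr -!scalerAl subrr add0r big_map mulr_sumr.
  rewrite (mulr_suml _ _ (fun p => p.1 *: p.2) X).
  rewrite (mulr_suml _ _ (fun p => p.1 *: p.2 * X)) -sumrB.
  by apply: eq_bigr => p _; rewrite scalerBr scalerAr !scalerAl.
have szL2 : (size L2 < n)%N by rewrite size_map.
have iX : integral_elt X by apply: (integralU 1).
apply: (IH L2) => //; rewrite ?L2E.
- move=> _ /mapP[p /iL' ip ->] /=; apply: integralD.
    by do 2?apply: integralM.
  by apply: integralN; do 2?apply: integralM.
- by rewrite subr_eq0; apply/eqP.
- by rewrite -mulN1r; apply: ID; [apply: IM|apply: IM; apply: (IMr a); apply: (IMr X)].
Qed.

Lemma ideal_integral (I : A -> Prop) u : star_condition G -> two_sided_ideal I ->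
    u != 0 -> I u ->
  exists v, [/\ integral_elt v, v != 0 & I v].
Proof.
move=> star idI u0 Iu.
have uE : u = \sum_(p <- [seq (u@_g, (<< 1 *g g >> : A)) | g <- msupp u]) p.1 *: p.2.
  rewrite big_map [LHS](galg_expand (fsubset_refl _)).
  by apply: eq_bigr => g _; rewrite galg_scaleU mulr1.
rewrite uE in u0 Iu; apply: (ideal_integral_comb star idI _ u0 Iu).
by move=> _ /mapP[g _ ->]; apply: (integralU 1).
Qed.

Lemma integral_enum : countably_infinite G ->
  exists e : nat -> A, forall v, integral_elt v -> exists n, e n = v.
Proof.
case=> f [f' _ fK].
pose s (l : seq (int * nat)) : A := \sum_(p <- l) << p.1%:~R *g f p.2 >>.
(* A number codes a list of pairs of a coefficient and the index of a group element; numbers that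
   code no list are sent to 0. *)
exists (fun n : nat => oapp s 0 (choice.unpickle n : option (seq (int * nat)))) => v iv.
have [z zE] := boolp.choice iv.
exists (choice.pickle [seq (z g, f' g) | g <- msupp v]);
  rewrite choice.pickleK /= /s big_map.
rewrite [RHS](galg_expand (fsubset_refl _)).
by apply: eq_bigr => g _; rewrite /= fK zE.
Qed.
End IntegralElements.

(** * Multipliers that do not shrink supports *)

Section ExpandingElements.
Variables (K : fieldType) (G : groupType).
Local Notation A := (groupAlgebra K G).

Lemma infinite_notin (S : {fset G}) : countably_infinite G -> exists h, h \notin S.
Proof.
case=> f /bij_inj f_inj; apply: NNPP => noh.
have sub : {subset map f (iota 0 #|` S|.+1) <= S}.
  by move=> h _; apply: NNPP => /negP hS; apply: noh; exists h.
have := uniq_leq_size _ sub; rewrite map_inj_uniq // iota_uniq => /(_ isT).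
by rewrite size_map size_iota ltnn.
Qed.

(** Translating by the inverse of an element outside the support keeps 1 out of the new support, so
    that all its elements may serve as factors of alternating words. *)
Lemma translate_notin1 (u : A) : countably_infinite G -> u != 0 ->
  exists h, let v := (<< 1 *g h >> : A) * u in v != 0 /\ 1%g \notin msupp v.
Proof.
move=> inf u0; have [h hS] := infinite_notin (msupp u) inf.
exists h^-1%g; split.
  apply: contraNneq u0 => e; have := congr1 (fun v => (<< 1 *g h >> : A) * v) e.
  by rewrite /= mulr0 mulrA galg_mulU mulr1 mulgV [_ * u](@galg_mul1g K G) => ->.
rewrite -mcoeff_eq0 (galg_mulUl _ (fsubset_refl _)) mcoeff_galg_sum.
rewrite big1_seq // => g /andP[_ gu]; rewrite mcoeffU; case: eqP => // e.
by move: hS; rewrite (_ : h = g) ?gu //; rewrite -[LHS]mulg1 -e mulVKg.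
Qed.

Definition conj_sum (x : 'I_3 -> G) (u : A) : A :=
  \sum_t (<< 1 *g (x t)^-1%g >> : A) * u * (<< 1 *g x t >> : A).

(** These are the factors that collisions between terms of a [conj_sum] produce: solving
    [g ^ x t * v = g' ^ x t' * v'] for [v'] gives one conjugate of [g'^-1 * g] if [t = t'], and
    conjugates of [g'^-1] and [g] otherwise. *)
Definition conj_labels (S : {fset G}) : {fset G} :=
  (S `|` [fset g^-1%g | g in S] `|` [fset (g'^-1 * g)%g | g' in S, g in S]) `\ 1%g.

(** In [spread_expand] the nodes are group elements, the ports the three conjugators, the points of
    a port the support of [u]. Leaving by another port keeps the accumulated word alternating, so a
    closed walk would be a forbidden relation. The factor obtained is [3 - 2] times the size of the
    support of [u]. *)
Lemma conj_sum_expanding x (u w : A) : u != 0 -> 1%g \notin msupp u ->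
    non_relation x (conj_labels (msupp u)) ->
  (#|` msupp w| <= #|` msupp (conj_sum x u * w)|)%N.
Proof.
move=> u0 u1 nonrel; set M := conj_labels _ in nonrel; pose S := msupp u.
have SM g : g \in S -> g \in M.
  move=> gS; rewrite !inE gS /= andbT.
  by apply: contraNneq u1 => <-.
have SVM g : g \in S -> g^-1%g \in M.
  move=> gS; rewrite !inE invg_eq1 (in_imfset _ (fun g => g^-1%g)) //= orbT andbT.
  by apply: contraNneq u1 => <-.
have SVSM g g' : g \in S -> g' \in S -> g <> g' -> (g'^-1 * g)%g \in M.
  move=> gS g'S gg'; rewrite !inE; apply/andP; split; last first.
    by apply/orP; right; apply: in_imfset2.
  by apply/eqP => e; apply: gg'; rewrite -[RHS]mulg1 -e mulVKg.
pose val (v : G) (t : 'I_3) (s : S) := ((fsval s) ^ x t * v)%g.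
pose E (v0 : G) (b : G * 'I_3) :=
  exists h, alternating x M b.2 h /\ b.1 = (h * v0)%g.
have stepP (v : G) t b : collide val (v, t) b -> exists h, b.1 = (h * v)%g /\
    alternating x M b.2 h /\
    forall t0 h0, t0 != t -> alternating x M t0 h0 -> alternating x M b.2 (h * h0)%g.
  case: b => v' t' [s [s' [ne /= e]]]; have [tt'|tt'] := eqVneq t' t.
    subst t'; exists (((fsval s')^-1 * fsval s) ^ x t)%g.
    have mM : ((fsval s')^-1 * fsval s)%g \in M.
      apply: SVSM; rewrite ?fsvalP // => /val_inj ss'; apply: ne.
      by rewrite ss' in e *; congr (_, _, _); apply: mulgI e.
    split; first by rewrite conjMg -mulgA [X in (_ * X)%g]e conjVg mulKg.
    split; first exact: alternating_one.
    by move=> t0 h0 /eqP t0t; apply: alternating_cons => // ?; apply: t0t.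
  exists (((fsval s')^-1 ^ x t') * (fsval s ^ x t))%g.
  have sM := SM _ (fsvalP s); have sVM := SVM _ (fsvalP s').
  split; first by rewrite -mulgA [X in (_ * X)%g]e conjVg mulKg.
  split; first by apply: (alternating_cons (t := t)) => //;
    [exact/eqP|exact: alternating_one].
  move=> t0 h0 /eqP t0t al0; rewrite -mulgA.
  apply: (alternating_cons (t := t)) => //; first exact/eqP.
  by apply: alternating_cons al0 => // ?; apply: t0t.
have E1 (v : G) t b : collide val (v, t) b -> E v b.
  by case/stepP => h [e [al _]]; exists h.
have ES (v0 v : G) t t1 b : E v0 (v, t) -> t1 != t -> collide val (v, t1) b -> E v0 b.
  case=> h0 [al0 /= ->] t1t /stepP[h [e [_ al]]]; exists (h * h0)%g.
  by split; [apply: al al0; rewrite eq_sym|rewrite e mulgA].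
have E_acyclic (v : G) t : ~ E v (v, t).
  case=> h [/nonrel h1 /= e]; apply: h1; apply: (mulIg v); by rewrite -e mul1g.
pose c (v : G) (t : 'I_3) (s : S) : K := u@_(fsval s) * w@_v.
have cnz : {in msupp w, forall v t s, c v t s != 0}.
  move=> v vw t s; rewrite mulf_neq0 // mcoeff_neq0 ?vw //; exact: fsvalP.
have := spread_expand E1 ES E_acyclic cnz.
have -> : \sum_(v <- msupp w) spread val c v = conj_sum x u * w.
  rewrite [w in RHS](galg_expand (fsubset_refl _)) mulr_sumr.
  apply: eq_bigr => v _; rewrite mulr_suml; apply: eq_bigr => t _.
  rewrite -mulrA galg_mulU mul1r (galg_mulUl _ (fsubset_refl _)) mulr_suml big_seq_fsetE.
  by apply: eq_bigr => s _; rewrite galg_mulU /val conjgE !mulgA.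
apply: leq_trans; rewrite card_ord subSnn mul1n leq_pmull //.
by rewrite -cardfE cardfs_gt0 galg_supp_eq0.
Qed.

Lemma ideal_expanding (u : A) : star_condition G -> countably_infinite G -> u != 0 ->
  exists a, (forall I : A -> Prop, two_sided_ideal I -> I u -> I a) /\
    forall w, (#|` msupp w| <= #|` msupp (a * w)|)%N.
Proof.
move=> star inf u0; have [h [v0 v1]] := translate_notin1 inf u0.
set v := _ * u in v0 v1.
have [|x nonrel] := star_non_relation (M := conj_labels (msupp v)) star.
  by rewrite !inE eqxx.
exists (conj_sum x v); split=> [I [I0 ID IM IMr] Iu|w]; last exact: conj_sum_expanding.
apply: (big_ind I) => // t _.
by apply: (IMr << 1 *g x t >>); apply: (IM << 1 *g (x t)^-1%g >>);
  apply: (IM << 1 *g h >>).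
Qed.

(** Five terms make five ports, hence the factor [5 - 2 = 3] in [spread_expand]; distinct [i] use
    disjoint blocks of the family. *)
Definition free_sum (p : nat -> G) (i : nat) : A :=
  \sum_(r < 5) << 1 *g p (5 * i + r)%N >>.

(** Nodes are pairs of an index [i] and a group element, with one point per port. A collision
    multiplies the group element by some [(p l)^-1 * p k] with [k <> l], so walks spell reduced
    words, and these are never 1. *)
Lemma free_sum_expanding p Q n (v : nat -> A) : reduced_family p Q ->
  (3 * \sum_(i < n) #|` msupp (v i)| <=
     #|` msupp (\sum_(i < n) free_sum p i * v i)|)%N.
Proof.
move=> [Qneq1 Qbase Qstep].
pose N : choiceType := (nat * G)%type.
pose k (w : N) (r : 'I_5) := (5 * w.1 + r)%N.
have k_inj (w : N) r (w' : N) r' : k w r = k w' r' -> w.1 = w'.1 /\ r = r'.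
  rewrite /k => e; have lr := ltn_ord r; have lr' := ltn_ord r'.
  by split; [lia|apply: val_inj => /=; lia].
pose val (w : N) (r : 'I_5) (s : unit) := (p (k w r) * w.2)%g.
pose E (w0 : N) (b : N * 'I_5) := exists h, Q (k b.1 b.2) h /\ b.1.2 = (h * w0.2)%g.
have stepP (w : N) r b : collide val (w, r) b ->
    k w r <> k b.1 b.2 /\ b.1.2 = ((p (k b.1 b.2))^-1 * p (k w r) * w.2)%g.
  case: b => w' r' [[] [[] [ne e]]].
  have {}e : (p (k w r) * w.2 = p (k w' r') * w'.2)%g := e.
  split; last by rewrite -mulgA e mulKg.
  move=> ek; rewrite ek in e; move/mulgI: e => e.
  have [e1 er] := k_inj _ _ _ _ ek; apply: ne; rewrite er; congr (_, _, _).
  by case: (w) (w') e1 e => [? ?] [? ?] /= -> ->.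
have E1 (w : N) r b : collide val (w, r) b -> E w b.
  by move=> /stepP[ne e];
    exists ((p (k b.1 b.2))^-1 * p (k w r))%g; split=> //; apply: Qbase.
have ES (w0 w : N) r r1 b : E w0 (w, r) -> r1 != r -> collide val (w, r1) b -> E w0 b.
  move=> [h [Qh /= eh]] r1r /stepP[ne e].
  exists ((p (k b.1 b.2))^-1 * p (k w r1) * h)%g; split; last by rewrite e eh !mulgA.
  apply: (Qstep _ _ _ _ Qh); last exact: nesym.
  by move=> /k_inj[_ er]; rewrite er eqxx in r1r.
have E_acyclic (w : N) r : ~ E w (w, r).
  by case=> h [/Qneq1 h1 /= e]; apply: h1; apply: (mulIg w.2); rewrite -e mul1g.
pose s := [seq ((i, g) : N) | i <- iota 0 n, g <- msupp (v i)].
have s_uniq : uniq s.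
  apply: allpairs_uniq_dep => [|i _|[i g] [i' g'] _ _ /= [-> ->]] //.
  exact: iota_uniq.
pose W := [fset w in s].
have WP : perm_eq W s.
  by apply: uniq_perm => [||w]; rewrite ?fset_uniq // !inE.
pose c (w : N) (r : 'I_5) (_ : unit) : K := (v w.1)@_w.2.
have cnz : {in W, forall w t s, c w t s != 0}.
  move=> w; rewrite !inE => /allpairsPdep[i [g [_ gi ->]]] r s0.
  by rewrite mcoeff_neq0.
have := spread_expand E1 ES E_acyclic cnz.
rewrite card_ord card_unit muln1 (perm_big _ WP) big_allpairs_dep /=.
have -> : #|` W| = (\sum_(i < n) #|` msupp (v i)|)%N.
  rewrite -sum1_size (perm_big _ WP) big_allpairs_dep
    -(big_mkord xpredT (fun i => #|` msupp (v i)|)) /=.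
  by rewrite /index_iota subn0; apply: eq_bigr => i _; rewrite sum1_size.
rewrite -(big_mkord xpredT (fun i => free_sum p i * v i)) /index_iota subn0.
congr (_ <= #|` msupp _|)%N; apply: eq_bigr => i _.
rewrite mulr_suml exchange_big /=; apply: eq_bigr => r _.
rewrite (galg_mulUl _ (fsubset_refl _)); apply: eq_bigr => g _.
rewrite (bigD1 tt) //= big1 ?addr0 //; by case.
Qed.
End ExpandingElements.

(** * Quotients by right ideals as modules over the converse ring *)

Section RightIdeals.
Variable R : nzRingType.

Definition right_ideal (X : R -> Prop) : Prop :=
  [/\ X 0, forall u v, X u -> X v -> X (u + v) & forall a u, X u -> X (u * a)].

Section Quotient.
Variables (X : R -> Prop) (rX : right_ideal X).

Definition right_ideal_pred (h : right_ideal X) : {pred R} := fun u => boolp.asbool (X u).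

Lemma right_ideal_zmod_closed : zmod_closed (right_ideal_pred rX).
Proof.
have [X0 XD XM] := rX; split; first exact/boolp.asboolP.
move=> u v /boolp.asboolP Xu /boolp.asboolP Xv; apply/boolp.asboolP.
by apply: XD => //; rewrite -mulrN1; apply: XM.
Qed.

HB.instance Definition _ :=
  GRing.isZmodClosed.Build R (right_ideal_pred rX) right_ideal_zmod_closed.

Definition right_quotient := Quotient.quot (right_ideal_pred rX).
HB.instance Definition _ := GRing.Zmodule.on right_quotient.

Local Notation pi := (\pi_(Quotient.quot (right_ideal_pred rX)))%qT.

Lemma right_quotient_eq u v : (pi u = pi v) <-> X (u - v).
Proof.
split=> [/eqP|Xuv]; first by rewrite -Quotient.idealrBE => /boolp.asboolP.
by apply/eqP; rewrite -Quotient.idealrBE; apply/boolp.asboolP.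
Qed.

Definition right_quotient_scale (a : R^c) (q : right_quotient) : right_quotient :=
  pi (repr q * (a : R)).

Lemma right_quotient_scale_pi a u :
  right_quotient_scale a (pi u) = pi (u * (a : R)).
Proof.
have [_ _ XM] := rX; apply/right_quotient_eq; rewrite -mulrBl; apply: XM.
by apply/right_quotient_eq; rewrite reprK.
Qed.

Lemma right_quotient_ind (P : right_quotient -> Prop) :
  (forall u, P (pi u)) -> forall q, P q.
Proof. by move=> Ppi q; rewrite -[q]reprK. Qed.

Lemma right_quotient_scaleA a b q : right_quotient_scale a (right_quotient_scale b q) =
  right_quotient_scale (a * b) q.
Proof.
elim/right_quotient_ind: q => u.
by rewrite !right_quotient_scale_pi -mulrA.
Qed.

Lemma right_quotient_scale1 : left_id 1 right_quotient_scale.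
Proof. by elim/right_quotient_ind => u; rewrite right_quotient_scale_pi mulr1. Qed.

Lemma right_quotient_scaleDr : right_distributive right_quotient_scale +%R.
Proof.
move=> a; elim/right_quotient_ind => u; elim/right_quotient_ind => v.
by rewrite -raddfD !right_quotient_scale_pi mulrDl raddfD.
Qed.

Lemma right_quotient_scaleDl q :
  {morph right_quotient_scale^~ q : a b / a + b}.
Proof.
by elim/right_quotient_ind: q => u a b; rewrite !right_quotient_scale_pi mulrDr raddfD.
Qed.

HB.instance Definition _ := GRing.Zmodule_isLmodule.Build R^c right_quotient
  right_quotient_scaleA right_quotient_scale1 right_quotient_scaleDr
  right_quotient_scaleDl.

End Quotient.
End RightIdeals.

(** * A criterion for right primitivity *)

Section Criterion.
Variable R : nzRingType.

(* [Zorn_bigcup] also requires the union of the empty chain to be admissible,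
   hence the first alternative in [P]. *)
Lemma maximal_right_ideal (X : R -> Prop) : right_ideal X -> ~ X 1 ->
  exists Y, [/\ right_ideal Y, forall u, X u -> Y u, ~ Y 1 &
    forall Z, right_ideal Z -> (forall u, Y u -> Z u) -> ~ Z 1 ->
      forall u, Z u -> Y u].
Proof.
move=> rX X1.
pose good (Y : R -> Prop) := [/\ right_ideal Y, forall u, X u -> Y u & ~ Y 1].
pose P (Y : classical_sets.set R) := (forall u, ~ Y u) \/ good Y.
have [F FP Ftot|Y [PY maxY]] := @classical_sets.Zorn_bigcup R P.
  have [[Y0 [FY0 gY0]]|noY] := classic (exists Y, F Y /\ good Y); last first.
    left=> u [Y FY Yu]; have [/(_ u)//|gY] := FP _ FY.
    by apply: noY; exists Y.
  have gF Y u : F Y -> Y u -> good Y by move=> FY Yu; have [/(_ u)|] := FP _ FY.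
  right; have [[Y00 _ _] XY0 _] := gY0; split.
  - split=> [|u v [Y FY Yu] [Z FZ Zv]|a u [Y FY Yu]]; first by exists Y0.
    + have [[_ YD _] _ _] := gF _ _ FY Yu; have [[_ ZD _] _ _] := gF _ _ FZ Zv.
      by have [YZ|ZY] := Ftot _ _ FY FZ; [exists Z|exists Y] => //;
        [apply: (ZD) => //; apply: YZ|apply: (YD) => //; apply: ZY].
    + by have [[_ _ YM] _ _] := gF _ _ FY Yu; exists Y => //; apply: YM.
  - by move=> u Xu; exists Y0 => //; apply: XY0.
  - by move=> [Y FY Y1]; have [_ _] := gF _ _ FY Y1.
have [X0 _ _] := rX.
have gY : good Y.
  (* A maximal [Y] cannot be empty, since [X] contains 0 and would be strictly larger. *)
  case: PY => // Y0; exfalso; apply: (maxY X); last by right; split.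
  by split=> [u /Y0|/(_ 0 X0)/Y0].
exists Y; have [rY XY Y1] := gY; split=> // Z rZ YZ Z1 u Zu; apply: NNPP => Yu.
apply: (maxY Z); last by right; split=> // v /XY/YZ.
by split=> [//|ZY]; apply: Yu; apply: ZY.
Qed.

(** The module is the quotient by a maximal right ideal [Y] above [X]. Its annihilator is a
    two-sided ideal inside [Y]; if non-zero, it contains some [u] with [1 + u] in [X], which would
    put 1 in [Y]. *)
Lemma right_primitive_criterion (X : R -> Prop) : right_ideal X -> ~ X 1 ->
    (forall I : R -> Prop, two_sided_ideal I -> (exists u, I u /\ u != 0) ->
      exists u, I u /\ X (1 + u)) ->
  right_primitive R.
Proof.
move=> rX X1 comax; have [Y [rY XY Y1 maxY]] := maximal_right_ideal rX X1.
have [Y0 YD YM] := rY.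
pose V : lmodType R^c := right_quotient rY.
have YN u : Y u -> Y (- u) by move=> Yu; rewrite -mulrN1; apply: YM.
pose pi (u : R) : V := (\pi_(Quotient.quot (right_ideal_pred rY)) u)%qT.
have piZ (a : R) u : (a : R^c) *: pi u = pi (u * a) by apply: right_quotient_scale_pi.
have pi0 u : pi u = 0 <-> Y u.
  have -> : (0 : V) = pi 0 by rewrite /pi raddf0.
  by rewrite /pi; split=> [/right_quotient_eq|h];
    [|apply/right_quotient_eq]; rewrite subr0.
have piP (v : V) : exists u, v = pi u.
  by elim/right_quotient_ind: v => u; exists u.
have piD u v : pi (u + v) = pi u + pi v by rewrite /pi raddfD.
exists V; split.
- move=> a aV; apply: NNPP => /eqP a0.
  pose I (b : R) := forall v : V, (b : R^c) *: v = 0.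
  have Iid : two_sided_ideal I.
    split=> [v|b c Ib Ic v|c b Ib v|c b Ib v].
    + exact: scale0r.
    + by rewrite [LHS]scalerDl Ib Ic addr0.
    + have -> : ((c * b : R) : R^c) = (b : R^c) * (c : R^c) by [].
      by rewrite -scalerA Ib.
    + have -> : ((b * c : R) : R^c) = (c : R^c) * (b : R^c) by [].
      by rewrite -scalerA Ib scaler0.
  have [|u [Iu Xu]] := comax I Iid; first by exists a.
  apply: Y1; have := Iu (pi 1); rewrite piZ mul1r => /pi0 Yu.
  by rewrite -[1](addrK u); apply: YD; [apply: XY|apply: YN].
- split; first by exists (pi 1) => /pi0.
  (* The preimage [Z] of a submodule is a right ideal containing [Y]; it contains 1 or, by
     maximality, lies in [Y]. *)
  move=> W [W0 WD WZ]; pose Z u := W (pi u).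
  have rZ : right_ideal Z.
    split=> [|u v|a u]; rewrite /Z; first by rewrite (pi0 0).2.
      by rewrite piD; apply: WD.
    by rewrite -piZ; apply: WZ.
  have YZ u : Y u -> Z u by rewrite /Z => /pi0 ->.
  have [Z1|Z1] := classic (Z 1).
    by right=> v; have [u ->] := piP v; rewrite -[u]mul1r -piZ; apply: WZ.
  left=> v; have [u ->] := piP v => Zu; apply/pi0.
  exact: maxY rZ YZ Z1 _ Zu.
Qed.
End Criterion.

(** * Properness of the right ideal, and the conclusion *)

Lemma card_msupp_sum (K : fieldType) (G : choiceType) n (w : nat -> {malg K[G]}) :
  (#|` msupp (\sum_(i < n) w i)%R| <= \sum_(i < n) #|` msupp (w i)|)%N.
Proof.
elim: n => [|n IH]; first by rewrite !big_ord0 msupp0 cardfs0.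
rewrite !big_ord_recr /=; apply: leq_trans (leq_add IH (leqnn _)).
by apply: leq_trans (fsubset_leq_card (msuppD_le _ _)) _; rewrite cardfsU leq_subr.
Qed.

Theorem mainTheorem2 (G : groupType) (hG : countably_infinite G)
    (hstar : star_condition G) (K : fieldType) :
  right_primitive (groupAlgebra K G).
Proof.
pose A := groupAlgebra K G.
have [g] := infinite_notin [fset 1%g] hG; rewrite inE => g1.
have [p [Q redp]] := star_reduced_family hstar g1.
have [e eP] := integral_enum K hG.
have aE n : exists a : A, (e n != 0 ->
      forall I : A -> Prop, two_sided_ideal I -> I (e n) -> I a) /\
    forall w, (#|` msupp w| <= #|` msupp (a * w)|)%N.
  (* For [e n = 0] the ideal condition is void, and the default 1 still satisfies the support
     inequality. *)
  have [en0|en0] := eqVneq (e n) 0; first by exists 1; split=> // w; rewrite mul1r.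
  by have [a [aI aexp]] := ideal_expanding hstar hG en0; exists a.
have [a aP] := boolp.choice aE.
pose eps i := 1 + free_sum K p i * a i.
pose X (u : A) := exists n (w : nat -> A), u = \sum_(i < n) eps i * w i.
have XD u v : X u -> X v -> X (u + v).
  move=> [m [w ->]] [n [z ->]].
  exists (maxn m n),
    (fun i => (if (i < m)%N then w i else 0) + (if (i < n)%N then z i else 0)).
  have pad k (y : nat -> A) : (k <= maxn m n)%N -> \sum_(i < k) eps i * y i =
      \sum_(i < maxn m n) eps i * (if (i < k)%N then y i else 0).
    move=> le; rewrite (big_ord_widen _ (fun i => eps i * y i) le) big_mkcond /=.
    by apply: eq_bigr => i _; case: ifP => // _; rewrite mulr0.
  rewrite (pad _ w) ?leq_maxl // (pad _ z) ?leq_maxr // -big_split /=.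
  by apply: eq_bigr => i _; rewrite mulrDr.
have rX : right_ideal X.
  split=> //; first by exists 0%N, (fun=> 0); rewrite big_ord0.
  move=> b _ [n [w ->]]; exists n, (fun i => w i * b).
  by rewrite mulr_suml; apply: eq_bigr => i _; rewrite mulrA.
apply: (right_primitive_criterion rX).
  move=> [n [w one]].
  have e1 : \sum_(i < n) free_sum K p i * (a i * w i) = 1 - \sum_(i < n) w i.
    rewrite one -sumrB; apply: eq_bigr => i _.
    by rewrite /eps mulrDl mul1r addrC addKr mulrA.
  have := free_sum_expanding n (fun i => a i * w i) redp; rewrite e1 => le3.
  have le1 : (#|` msupp (1 - \sum_(i < n) w i)| <= 1 + \sum_(i < n) #|` msupp (w i)|)%N.
    apply: leq_trans (fsubset_leq_card (msuppB_le _ _)) _.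
    apply: leq_trans (_ : #|` msupp (1 : A)| + #|` msupp (\sum_(i < n) w i)%R| <= _)%N.
      by rewrite cardfsU leq_subr.
    apply: leq_add; last exact: card_msupp_sum.
    by rewrite -(cardfs1 (1%g : G)); apply: fsubset_leq_card; apply: msuppU_le.
  have le2 : (\sum_(i < n) #|` msupp (w i)| <= \sum_(i < n) #|` msupp (a i * w i)|)%N.
    by apply: leq_sum => i _; apply: (aP i).2.
  (* From [3 * N <= 1 + N] in the natural numbers follows [N = 0]. Then each [a i * w i] vanishes,
     hence each [w i], contradicting that the sum is 1. *)
  have /eqP : (\sum_(i < n) #|` msupp (a i * w i)|)%N = 0%N by lia.
  rewrite sum_nat_eq0 => /forallP all0; have /eqP := oner_neq0 A; apply.
  rewrite one big1 // => i _; suff -> : w i = 0 by rewrite mulr0.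
  apply/eqP; rewrite -galg_supp_eq0 -cardfs_eq0 -leqn0.
  by apply: leq_trans ((aP i).2 _) _; rewrite leqn0; apply: all0.
move=> I idI [u [Iu u0]].
have [v [/eP[n <-] en0 Ien]] := ideal_integral hstar idI u0 Iu.
exists (free_sum K p n * a n); split.
  by have [_ _ IM _] := idI; apply: IM; apply: (aP n).1.
exists n.+1, (fun i => (i == n)%:R); rewrite big_ord_recr /= eqxx mulr1.
by rewrite big1 ?add0r // => i _; rewrite ltn_eqF // mulr0.
Qed.
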